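(* There is a $[Dn,Wn]$-scheme for weighted \textsc{SSSP} on $n$-vertex graphs in the vanilla streaming model, where $D$ is the largest distance from the source $v_s$ to any vertex reachable from it and $W$ is the maximum weight of an edge.
   Context: Annotated streaming model (schemes): a space-bounded Verifier reads an input stream; after the stream ends, an all-powerful Prover sends a help message to the Verifier as a stream, and the Verifier either outputs the answer or rejects ($\bot$). Requirements: perfect completeness (with the honest help the Verifier produces the correct output with probability 1) and soundness error at most $1/3$ (for every input and every help message, the probability that the Verifier produces an incorrect output rather than rejecting is at most $1/3$). A $[h,v]$-scheme uses $\tilde{O}(h)$ bits of help and $\tilde{O}(v)$ bits of Verifier space, where $\tilde{O}$ hides factors polynomial in $\log n$. Vanilla streaming model (weighted): the graph on vertex set $[n]$ is given as a stream of tokens $(u,v,w)$, each giving an edge $\{u,v\}$ together with its weight $w\in\{1,\dots,W\}$, with no further updates to edges. Weighted \textsc{SSSP}: for a source vertex $v_s$, determine the distance (weight of a shortest path) from $v_s$ to every vertex reachable from it, and identify unreachable vertices. *)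

(* Defs.v *)
From mathcomp Require Import all_boot.
Set Implicit Arguments. Unset Strict Implicit. Unset Printing Implicit Defensive.

(* A token (u, v, w) gives the undirected edge {u,v} with weight w.
   Vertices are 0, ..., n-1 (the paper's [n], shifted by one). *)
Definition token := (nat * nat * nat)%type.

Definition valid_stream (n W : nat) (s : seq token) : Prop :=
  (forall u v w, (u, v, w) \in s -> [/\ u < n, v < n, u != v & 1 <= w <= W])
  /\ uniq [seq (minn t.1.1 t.1.2, maxn t.1.1 t.1.2) | t <- s].

Definition sedge (s : seq token) (x y w : nat) : Prop :=
  (x, y, w) \in s \/ (y, x, w) \in s.

Inductive walk (s : seq token) : nat -> nat -> nat -> Prop :=
| walk_nil x : walk s x x 0
| walk_cons x y z w d : sedge s x y w -> walk s y z d -> walk s x z (w + d).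

Definition sssp_correct n (s : seq token) (vs : 'I_n) (a : 'I_n -> option nat) : Prop :=
  forall v : 'I_n,
    match a v with
    | Some d => walk s vs v d /\ (forall d', walk s vs v d' -> d <= d')
    | None => forall d, ~ walk s vs v d
    end.

Definition max_dist n (a : 'I_n -> option nat) : nat :=
  \max_(v : 'I_n) odflt 0 (a v).

(* A verifier with [sp] bits of memory: its memory contents are an element of
   'I_(2^sp).  Its private randomness is a uniformly random seed among
   [nseeds] <= 2^sp seeds (i.e. at most sp random bits, which it may keep in
   memory).  It reads the input stream token by token, then the help message
   bit by bit, and finally outputs Some answer or None (= reject, bottom). *)
Record verifier (Tok Out : Type) (sp : nat) := Verifier {
  nseeds : nat;
  nseeds_pos : 0 < nseeds;
  nseeds_le : nseeds <= 2 ^ sp;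
  v_init : 'I_nseeds -> 'I_(2 ^ sp);
  v_step_in : 'I_nseeds -> 'I_(2 ^ sp) -> Tok -> 'I_(2 ^ sp);
  v_step_help : 'I_nseeds -> 'I_(2 ^ sp) -> bool -> 'I_(2 ^ sp);
  v_out : 'I_nseeds -> 'I_(2 ^ sp) -> option Out
}.

Definition run Tok Out sp (V : verifier Tok Out sp) (r : 'I_(nseeds V))
  (input : seq Tok) (help : seq bool) : option Out :=
  v_out r (foldl (v_step_help r) (foldl (v_step_in r) (v_init r) input) help).

Arguments run {Tok Out sp} V r input help.

(* polylog factor (log n)^k, written with the ceiling log, shifted to be >= 1 *)
Definition polylog (n k : nat) : nat := (up_log 2 n).+1 ^ k.

(* Main.v *)
Require Import Defs.
From mathcomp Require Import all_boot.
From mathcomp Require Import zify.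

Set Implicit Arguments.
Unset Strict Implicit.
Unset Printing Implicit Defensive.

(** While reading the stream the verifier stores the sketch
    f(w, v) = sum_u A_w(u, v) r_u of each weight class of the adjacency matrix,
    for one random vector r in {0, 1, 2}^n, and the partition of the vertices
    into connected components.  For d = 1, 2, ..., D the help lists, for every
    v, the number z_d(v) of edges (u, v, w) with dist(u) + w = d.  The distances
    below d being known, r . z_d must equal the sum of f(d - dist(u), u) over
    the labelled u, which tests the claimed z_d (Freivalds); a still unlabelled
    v has distance d exactly when z_d(v) > 0.  The verifier accepts if in the
    end the whole component of the source is labelled.  A false vector passes
    the test for at most a third of the r, and no union bound over the levels
    is needed, since only the first false level has to be caught. *)

(** * Verifiers that read their help in blocks of fixed length *)

Section BlockVerifier.

Variables (Tok Out : Type) (Seed M H Z : finType) (b sp : nat) (z0 : Z).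
Variables (m0 : M) (step_in : Seed -> M -> Tok -> M).
Variables (h0 : H) (step_block : Seed -> M -> H -> Z -> H).
Variable out : M -> H -> option Out.
Hypotheses (b_gt0 : 0 < b) (leZ : #|Z| <= 2 ^ b).
Hypotheses (seed_gt0 : 0 < #|Seed|) (leSeed : #|Seed| <= 2 ^ sp).

Let state := (M * (H * 'I_(2 ^ b)))%type.
Hypothesis leState : #|{: state}| <= 2 ^ sp.

(** Codes outside the range of [Z] decode to [z0], so that every bit string, honest or not, reads as
    a sequence of blocks. *)
Let block_of_nat (x : nat) : Z :=
  odflt z0 (omap enum_val (insub x : option 'I_#|Z|)).

Let block_of_natK (z : Z) : block_of_nat (enum_rank z) = z.
Proof. by rewrite /block_of_nat valK /= enum_rankK. Qed.

(* The bits of the current block are kept in binary after a leading 1, so that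
   the block is complete exactly when the number reaches 2 ^ b. *)
Fixpoint parse (m : nat) (help : seq bool) : seq Z :=
  if help is x :: help' then
    if m.*2 + x < 2 ^ b then parse (m.*2 + x) help'
    else block_of_nat (m.*2 + x - 2 ^ b) :: parse 1 help'
  else [::].

(** The bounds say that [m] is a leading 1 followed by all but [k.+1] of the [b] bits, so the block
    completes exactly [k.+1] bits later. *)
Lemma parse_block k m v : 2 ^ b <= m * 2 ^ k.+1 ->
    m.+1 * 2 ^ k.+1 <= 2 * 2 ^ b -> v < 2 ^ k.+1 ->
  exists2 l, size l = k.+1 & forall help,
    parse m (l ++ help) = block_of_nat (m * 2 ^ k.+1 + v - 2 ^ b) :: parse 1 help.
Proof.
elim: k m v => [|k IHk] m v lo hi ltv.
  exists [:: v == 1] => //= help; rewrite expn1 in lo hi ltv *.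
  have -> : m.*2 + (v == 1) = m * 2 + v by lia.
  by rewrite ltnNge (leq_trans lo) ?leq_addr.
have def2 : 2 ^ k.+2 = 2 * 2 ^ k.+1 by rewrite expnS.
pose x := 2 ^ k.+1 <= v.
have lt_m : m.*2 + x < 2 ^ b.
  have : 4 <= 2 ^ k.+2 by rewrite (@leq_exp2l 2 2).
  by rewrite /x; nia.
have [|||l sz_l parse_l] := IHk (m.*2 + x) (v - x * 2 ^ k.+1); try by rewrite /x; nia.
exists (x :: l) => [|help] /=; first by rewrite sz_l.
rewrite lt_m parse_l; congr (block_of_nat _ :: _).
by rewrite /x; nia.
Qed.

Lemma parse_surj zs : exists2 help, size help = b * size zs & parse 1 help = zs.
Proof.
elim: zs => [|z zs [help sz_help parse_help]]; first by exists [::]; rewrite ?muln0.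
have := @parse_block b.-1 1 (enum_rank z); rewrite prednK // mul1n addKn.
rewrite block_of_natK => -[||| l sz_l parse_l] //; first exact: leq_trans leZ.
exists (l ++ help); first by rewrite size_cat sz_l sz_help mulnS.
by rewrite parse_l parse_help.
Qed.

Let enc (x : state) : 'I_(2 ^ sp) := widen_ord leState (enum_rank x).

Let lt_1_exp : 1 < 2 ^ b. Proof. by rewrite (@ltn_exp2l 2 0). Qed.

Let st0 : state := (m0, (h0, Ordinal lt_1_exp)).

Let dec (i : 'I_(2 ^ sp)) : state :=
  odflt st0 (omap enum_val (insub (val i) : option 'I_#|{: state}|)).

Let encK : cancel enc dec.
Proof. by move=> x; rewrite /dec /= valK /= enum_rankK. Qed.

Let step_bit r (st : state) (x : bool) : state :=
  let: (m, (h, i)) := st in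
  if insub (i.*2 + x) is Some j then (m, (h, j))
  else (m, (step_block r m h (block_of_nat (i.*2 + x - 2 ^ b)), Ordinal lt_1_exp)).

Let step_tok r (st : state) (t : Tok) : state := (step_in r st.1 t, st.2).

Let foldl_step_tok r s m hi :
  foldl (step_tok r) (m, hi) s = (foldl (step_in r) m s, hi).
Proof. by elim: s m => //= t s IHs m; rewrite IHs. Qed.

Let foldl_step_bit r help m h (i : 'I_(2 ^ b)) :
  exists j, foldl (step_bit r) (m, (h, i)) help =
            (m, (foldl (step_block r m) h (parse i help), j)).
Proof.
elim: help h i => [|x help IHhelp] h i /=; first by exists i.
by case: insubP => [j -> <-|/negPf->] /=; apply: IHhelp.
Qed.

Let foldl_enc (A : Type) (f : state -> A -> state) st s :
  foldl (fun i x => enc (f (dec i) x)) (enc st) s = enc (foldl f st s).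
Proof. by elim: s st => //= x s IHs st; rewrite encK IHs. Qed.

(** The memory holds the stream memory, the block state and the unfinished block. As the last clause
    covers arbitrary help, soundness need only be shown against sequences of blocks. *)
Lemma block_verifier :
  exists (V : verifier Tok Out sp) (e : 'I_(nseeds V) -> Seed)
    (blocks : seq bool -> seq Z),
  [/\ nseeds V = #|Seed|, injective e,
      forall zs, exists2 help, size help = b * size zs & blocks help = zs &
      forall i s help, run V i s help =
        let m := foldl (step_in (e i)) m0 s in
        out m (foldl (step_block (e i) m) h0 (blocks help))].
Proof.
pose V := @Verifier Tok Out sp #|Seed| seed_gt0 leSeed (fun=> enc st0)
  (fun i x t => enc (step_tok (enum_val i) (dec x) t))
  (fun i x y => enc (step_bit (enum_val i) (dec x) y))
  (fun i x => let st := dec x in out st.1 st.2.1).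
exists V, enum_val, (parse 1); split=> //; first exact: enum_val_inj.
  exact: parse_surj.
move=> i s help; rewrite /run /= !foldl_enc encK foldl_step_tok.
by have [j ->] := foldl_step_bit (enum_val i) help
  (foldl (step_in (enum_val i)) m0 s) h0 (Ordinal lt_1_exp).
Qed.

End BlockVerifier.

(* Once the other coordinates are fixed, at most one of the three values of
   [r v] satisfies the equation. *)
Lemma card_dot_collision (I : finType) (z y : I -> nat) (v : I) : z v != y v ->
  3 * #|[set r : {ffun I -> 'I_3} | \sum_u z u * r u == \sum_u y u * r u]|
    <= 3 ^ #|I|.
Proof.
move=> neq_v; set B := [set r | _].
pose upd (p : {ffun I -> 'I_3} * 'I_3) := [ffun u => if u == v then p.2 else p.1 u].
have upd_inj : {in setX B [set: 'I_3] &, injective upd}.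
  move=> [r a] [r' a']; rewrite !inE !andbT /= => /eqP Er /eqP Er' /ffunP Eupd.
  have Ea : a = a' by have := Eupd v; rewrite !ffunE eqxx.
  have Eoff u : u != v -> r u = r' u.
    by move=> /negPf neq_uv; have := Eupd u; rewrite !ffunE neq_uv.
  suff Ev : r v = r' v.
    congr (_, _) => //; apply/ffunP => u.
    by have [->|/Eoff] := eqVneq u v.
  have split_v (x : I -> nat) (q : {ffun I -> 'I_3}) :
    \sum_u x u * q u = x v * q v + \sum_(u | u != v) x u * q u by rewrite (bigD1 v).
  have off (x : I -> nat) : \sum_(u | u != v) x u * r u = \sum_(u | u != v) x u * r' u.
    by apply: eq_bigr => u /Eoff->.
  (* Subtracting the equations gives [(z v - y v) * (r v - r' v) = 0] over the integers. *)
  move: Er Er'; rewrite !split_v !off.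
  move=> Er Er'; apply/ord_inj; move: (ltn_ord (r v)) (ltn_ord (r' v)) neq_v Er Er'.
  move: (nat_of_ord (r v)) (nat_of_ord (r' v)) => [|[|[|//]]] [|[|[|//]]] //=; lia.
have <- : #|{ffun I -> 'I_3}| = 3 ^ #|I| by rewrite card_ffun card_ord.
have -> : 3 * #|B| = #|setX B [set: 'I_3]| by rewrite cardsX cardsT card_ord mulnC.
by rewrite -(card_in_imset upd_inj) max_card.
Qed.

(** * Walks in the graph of a stream *)

Lemma sedge_sym s x y w : sedge s x y w -> sedge s y x w.
Proof. by case; [right | left]. Qed.

Lemma walk_rcons s x y z w d :
  walk s x y d -> sedge s y z w -> walk s x z (d + w).
Proof.
elim=> [{}x|{}x u {}y w' d' xu _ IH] yz.
  by rewrite add0n -[w]addn0; apply: walk_cons yz (walk_nil _ _).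
by rewrite -addnA; apply: walk_cons xu (IH yz).
Qed.

(** Walks grow at the front, but the arguments on distances look at the last edge. *)
Lemma walk_last s x z d : walk s x z d ->
  (x = z /\ d = 0) \/
  exists y d' w, [/\ walk s x y d', sedge s y z w & d = d' + w].
Proof.
elim=> [{}x|{}x u {}z w d' xu _ IH]; [by left | right].
case: IH => [[<- ->]|[y [d'' [w' [uy yz ->]]]]].
  by exists x, 0, w; rewrite addnC; split=> //; apply: walk_nil.
by exists y, (w + d''), w'; rewrite addnA; split=> //; apply: walk_cons xu uy.
Qed.

Lemma walk_cat s x y z d d' : walk s x y d -> walk s y z d' -> walk s x z (d + d').
Proof.
elim=> [//|{}x u {}y w e xu _ IH] yz.
by rewrite -addnA; apply: walk_cons xu (IH yz).
Qed.

Lemma walk_sym s x y d : walk s x y d -> walk s y x d.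
Proof.
elim=> [{}x|{}x u {}y w e xu _ IH]; first exact: walk_nil.
by rewrite addnC; apply: walk_rcons IH (sedge_sym xu).
Qed.

Lemma walk_sub (s s' : seq token) x y d :
  {subset s <= s'} -> walk s x y d -> walk s' x y d.
Proof.
move=> sub; elim=> [{}x|{}x u {}y w e xu _ IH]; first exact: walk_nil.
apply: walk_cons IH; case: xu => [/sub|/sub]; by [left | right].
Qed.

Definition joins (u v w : nat) (t : token) : bool :=
  (t == (u, v, w)) || (t == (v, u, w)).

Definition multiplicity (s : seq token) (u v w : nat) : nat := count (joins u v w) s.

Lemma multiplicity_gt0P s u v w : reflect (sedge s u v w) (0 < multiplicity s u v w).
Proof.
rewrite -has_count; apply: (iffP hasP) => [[t t_s]|].
  by case/orP=> /eqP def_t; rewrite def_t in t_s; [left | right].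
by case=> uvw; [exists (u, v, w) | exists (v, u, w)]; rewrite // /joins eqxx ?orbT.
Qed.

(** * Edge multiplicities and a bound on distances *)

Section Graph.

Variables (n W : nat) (vs : 'I_n).

Lemma sedge_bounds s u v w : valid_stream n W s -> sedge s u v w ->
  [/\ u < n, v < n & 1 <= w <= W].
Proof. by case=> bnd _ [] /bnd[]. Qed.

Lemma multiplicity_le1 s u v w : valid_stream n W s -> multiplicity s u v w <= 1.
Proof.
case=> _ uniq_s; pose key (t : token) := (minn t.1.1 t.1.2, maxn t.1.1 t.1.2).
have : count (fun t => key t == (minn u v, maxn u v)) s <= 1.
  rewrite -(count_map key (pred1 (minn u v, maxn u v))).
  by rewrite (count_uniq_mem _ uniq_s) leq_b1.
apply: leq_trans; apply: sub_count => t /orP[]/eqP->; rewrite /key //=.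
by rewrite minnC maxnC.
Qed.

Lemma sssp_correct_le s a : valid_stream n W s -> sssp_correct s vs a ->
  max_dist a <= n * W.
Proof.
move=> valid_s a_ok.
pose below e := [set u : 'I_n | if a u is Some e' then e' < e else false].
(* The predecessor [u] on a shortest walk is nearer by at most [W] and has strictly fewer vertices
   below it. *)
have dist_le m (v : 'I_n) e : e <= m -> a v = Some e -> e <= #|below e| * W.
  elim: m v e => [|m IHm] v e le_em av.
    by rewrite leqn0 in le_em; rewrite (eqP le_em).
  have := a_ok v; rewrite av => -[walk_e min_e].
  case: (walk_last walk_e) => [[_ ->] //|[y [d [w [walk_d yv def_e]]]]].
  have [lt_yn _ /andP[w_gt0 le_wW]] := sedge_bounds valid_s yv.
  pose u := Ordinal lt_yn; have := a_ok u.
  case au: (a u) => [d'|]; last by move/(_ d).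
  case=> walk_d' min_d'; have le_d'd := min_d' d walk_d.
  have proper : below d' \proper below e.
    apply/properP; split; last by exists u; rewrite !inE au ?ltnn //; lia.
    apply/subsetP=> x; rewrite !inE; case: (a x) => // e' lt_e'; lia.
  have le_e : e <= d' + w by apply: min_e; apply: walk_rcons walk_d' yv.
  have := IHm u d' _ au; have := proper_card proper; nia.
apply/bigmax_leqP => v _; case av: (a v) => [e|] //=.
apply: leq_trans (dist_le e v e _ av) _ => //.
by rewrite leq_mul // (leq_trans (max_card _)) ?card_ord.
Qed.

(** * Linear sketch of the weight classes *)

Local Notation dist := 'I_(n * W).+1.
Local Notation labelling := {ffun 'I_n -> option dist}.
Local Notation level := {ffun 'I_n -> 'I_n.+1}.
Local Notation seed := {ffun 'I_n -> 'I_3}.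
Local Notation sketch := {ffun 'I_W.+1 * 'I_n -> 'I_(2 * n).+1}.
Local Notation partition := {ffun 'I_n -> 'I_n}.

(* Weights are indexed from 0 to W; the row of weight 0 is never used. *)
Definition sketch0 : sketch := [ffun=> ord0].

Definition sketch_step (r : seed) (f : sketch) (t : token) : sketch :=
  [ffun p => inord (f p + \sum_(u < n) joins u p.2 p.1 t * r u)].

(** With multiplicities at most 1 and [r u] at most 2, a cell never exceeds [2 * n], so [inord]
    loses nothing. *)
Lemma sketchE r s w v : (forall u v w, multiplicity s u v w <= 1) ->
  foldl (sketch_step r) sketch0 s (w, v) = \sum_(u < n) multiplicity s u v w * r u :> nat.
Proof.
elim/last_ind: s => [|s t IHs] mult_le1.
  by rewrite ffunE big1.
have multE u v' w' : multiplicity (rcons s t) u v' w' =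
    multiplicity s u v' w' + joins u v' w' t.
  by rewrite /multiplicity -cats1 count_cat /= addn0.
have sumE : \sum_(u < n) multiplicity (rcons s t) u v w * r u =
    \sum_(u < n) multiplicity s u v w * r u + \sum_(u < n) joins u v w t * r u.
  by rewrite -big_split; apply: eq_bigr => u _ /=; rewrite multE mulnDl.
rewrite foldl_rcons ffunE IHs => [|u v' w']; last first.
  by apply: leq_trans (mult_le1 u v' w'); rewrite multE leq_addr.
rewrite -sumE inordK // ltnS mulnC -[X in X * 2]card_ord -sum_nat_const.
by apply: leq_sum => u _; apply: (@leq_mul _ _ 1 2) => //; apply: (ltn_ord (r u)).
Qed.

(** * Connected components *)

Definition partition0 : partition := [ffun v => v].

(** The whole class of one endpoint takes the name of the other's class; the default [vs] is never
    reached on valid tokens. *)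
Definition merge (c : partition) (t : token) : partition :=
  [ffun v => if c v == c (insubd vs t.1.1) then c (insubd vs t.1.2) else c v].

Lemma partitionP s (x y : 'I_n) : valid_stream n W s ->
  reflect (exists d, walk s x y d)
          (foldl merge partition0 s x == foldl merge partition0 s y).
Proof.
case=> bnd _; have {}bnd u v w : (u, v, w) \in s -> u < n /\ v < n by move/bnd=> [].
have insubdE u : u < n -> val (insubd vs u) = u by move=> lt_un; rewrite val_insubd lt_un.
apply: (iffP eqP) => [|[d walk_d]].
  elim/last_ind: s bnd x y => [|s [[u v] w] IHs] bnd x y.
    by rewrite !ffunE => ->; exists 0; apply: walk_nil.
  have [lt_un lt_vn] : u < n /\ v < n by apply: (bnd u v w); rewrite mem_rcons mem_head.
  have {}IHs (x' y' : 'I_n) : foldl merge partition0 s x' = foldl merge partition0 s y' ->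
      exists d, walk (rcons s (u, v, w)) x' y' d.
    case/IHs=> [a b c in_s|d /(walk_sub _) walk_d].
      by apply: (bnd a b c); rewrite mem_rcons in_cons in_s orbT.
    by exists d; apply: walk_d => t t_s; rewrite mem_rcons in_cons t_s orbT.
  have walk_uv : walk (rcons s (u, v, w)) (insubd vs u) (insubd vs v) (w + 0).
    rewrite !insubdE //; apply: walk_cons (walk_nil _ _).
    by left; rewrite mem_rcons mem_head.
  rewrite foldl_rcons !ffunE /=.
  (* Cases on whether [x] and [y] lay in the renamed class; if just one did, the walk may use the
     new edge. *)
  case: eqP => [/IHs[dx wx]|_]; case: eqP => [/IHs[dy wy]|_].
  - by move=> _; exists (dx + dy); apply: walk_cat wx (walk_sym wy).
  - case/IHs=> dy wy; exists (dx + (w + 0) + dy).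
    exact: walk_cat (walk_cat wx walk_uv) wy.
  - move/esym; case/IHs=> dx wx; exists (dy + (w + 0) + dx).
    exact: walk_sym (walk_cat (walk_cat wy walk_uv) wx).
  - exact: IHs.
have edge_eq u v w : (u, v, w) \in s ->
    foldl merge partition0 s (insubd vs u) = foldl merge partition0 s (insubd vs v).
  elim/last_ind: s {bnd x y d walk_d} => [|s t IHs] //.
  rewrite mem_rcons in_cons foldl_rcons !ffunE => /orP[/eqP <-|/IHs ->] //=.
  by rewrite eqxx if_same.
suff : foldl merge partition0 s (insubd vs (x : nat)) =
    foldl merge partition0 s (insubd vs (y : nat)).
  by rewrite !valKd.
by elim: walk_d => {x y d}// x z y w e [] /edge_eq-> _.
Qed.

(* [tight L d v] counts the edges that enter [v] at distance [d] from a vertex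
   labelled by [L]; the honest prover sends [tight L d] for d = 1, 2, ... *)
Definition tight (s : seq token) (L : labelling) (d : nat) (v : 'I_n) : nat :=
  \sum_(u < n) if L u is Some e then
    if d - e <= W then multiplicity s u v (d - e) else 0 else 0.

Definition sketched_tight (f : sketch) (L : labelling) (d : nat) : nat :=
  \sum_(u < n) if L u is Some e then
    if d - e <= W then nat_of_ord (f (inord (d - e), u)) else 0 else 0.

(** Exchange the sums over [u] and [v] and use the symmetry of [multiplicity]. *)
Lemma sketched_tightE r s L d : valid_stream n W s ->
  sketched_tight (foldl (sketch_step r) sketch0 s) L d = \sum_(v < n) tight s L d v * r v.
Proof.
move=> valid_s; have mult_le1 u v w := @multiplicity_le1 s u v w valid_s.
under [RHS]eq_bigr => v _ do rewrite /tight big_distrl.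
rewrite exchange_big /=; apply: eq_bigr => u _.
case: (L u) => [e|]; last by rewrite big1.
case: ifP => [le_W|_]; last by rewrite big1.
rewrite sketchE // inordK //; apply: eq_bigr => v _; congr (_ * _).
by apply: eq_count => t; rewrite /joins orbC.
Qed.

Lemma tight_le s L d v : valid_stream n W s -> tight s L d v <= n.
Proof.
move=> valid_s; have -> : n = \sum_(u < n) 1 by rewrite sum1_card card_ord.
apply: leq_sum => u _.
case: (L u) => [e|] //; case: ifP => // _; exact: multiplicity_le1.
Qed.

(** * Labels exact up to a given distance *)

Definition exact_up_to s (d : nat) (L : labelling) : Prop := forall v : 'I_n,
  if L v is Some e then
    [/\ e <= d, walk s vs v e & forall d', walk s vs v d' -> e <= d']
  else forall d', walk s vs v d' -> d < d'.

Definition labels0 : labelling := [ffun v => if v == vs then Some ord0 else None].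

Definition add_level (L : labelling) (d : nat) (z : level) : labelling :=
  [ffun v => if L v is None then if 0 < z v then Some (inord d) else None else L v].

Lemma exact_labels0 s : valid_stream n W s -> exact_up_to s 0 labels0.
Proof.
move=> valid_s v; rewrite ffunE; have [->|neq_v] := eqVneq v vs.
  by split=> //; apply: walk_nil.
move=> d /walk_last[[eq_v]|[y [d' [w [_ /(sedge_bounds valid_s)[_ _]]]]]]; last lia.
by case/eqP: neq_v; apply/val_inj.
Qed.

(** Weights are positive, so the last vertex before [v] on a shortest walk of length [d.+1] is
    already labelled and its edge is counted by [tight]. *)
Lemma exact_add_level s d (L : labelling) (z : level) :
    valid_stream n W s -> exact_up_to s d L -> d < n * W ->
    (forall v, z v = tight s L d.+1 v :> nat) ->
  exact_up_to s d.+1 (add_level L d.+1 z).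
Proof.
move=> valid_s L_ok lt_d zE v; have := L_ok v; rewrite ffunE.
case Lv: (L v) => [e|]; first by case=> le_ed walk_e min_e; split=> //; apply: leqW.
move=> gt_d; rewrite zE; case: posnP => [tight0|].
  move=> d' walk_d'; have := gt_d d' walk_d'; rewrite leq_eqVlt => /orP[/eqP def_d'|//].
  case: (walk_last walk_d') => [[_ d'0]|[y [e [w [walk_e yv eq_d']]]]].
    by rewrite d'0 in def_d'.
  have [lt_yn _ /andP[w_gt0 le_wW]] := sedge_bounds valid_s yv.
  pose u := Ordinal lt_yn; have := L_ok u.
  case Lu: (L u) => [e'|]; last by move/(_ e walk_e); lia.
  case=> _ walk_e' /(_ e walk_e) le_e'e.
  (* The walk through the label of [u] has length at most [d.+1], and more than [d] because [v] is
     unlabelled. *)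
  have def_w : d.+1 - e' = w.
    by have := gt_d _ (walk_rcons walk_e' yv); lia.
  move/eqP: tight0; rewrite sum_nat_eq0 => /forallP/(_ u).
  by rewrite Lu def_w le_wW -leqn0 leqNgt; move/multiplicity_gt0P: yv => ->.
rewrite lt0n sum_nat_eq0 negb_forall => /existsP[u]; have := L_ok u.
case: (L u) => [e|] //= [le_ed walk_e _]; case: ifP => // _.
rewrite -lt0n => /multiplicity_gt0P uv; rewrite inordK ?ltnS //.
split=> //; have := walk_rcons walk_e uv; rewrite subnKC //; exact: leqW.
Qed.

(** * The protocol, its soundness and its completeness *)

Local Notation progress := (bool * dist * labelling)%type.
Local Notation memory := (sketch * partition)%type.

Definition progress0 : progress := (true, ord0, labels0).

(* At [d = n * W] the next level would overflow [dist]; distances never exceed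
   this bound (see [sssp_correct_le]), so the verifier may reject. *)
Definition read_level (r : seed) (m : memory) (h : progress) (z : level) : progress :=
  let: (ok, d, L) := h in
  ([&& ok, d < n * W & \sum_(v < n) z v * r v == sketched_tight m.1 L d.+1],
   inord d.+1, add_level L d.+1 z).

Definition read_token (r : seed) (m : memory) (t : token) : memory :=
  (sketch_step r m.1 t, merge m.2 t).

Definition answer (m : memory) (h : progress) : option ('I_n -> option nat) :=
  let: (ok, _, L) := h in
  if ok && [forall v, (m.2 v == m.2 vs) ==> L v] then
    Some (fun v => omap (@nat_of_ord _) (L v))
  else None.

Let memory_of r s : memory := foldl (read_token r) (sketch0, partition0) s.

Lemma memory_ofE r s :
  memory_of r s = (foldl (sketch_step r) sketch0 s, foldl merge partition0 s).
Proof.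
by rewrite /memory_of; elim: s sketch0 partition0 => //= t s IHs f c; rewrite IHs.
Qed.

(** The final test leaves unlabelled only vertices outside the component of the source, which are
    unreachable. *)
Lemma exact_correct s d L : valid_stream n W s -> exact_up_to s d L ->
    [forall v, (foldl merge partition0 s v == foldl merge partition0 s vs) ==> L v] ->
  sssp_correct s vs (fun v => omap (@nat_of_ord _) (L v)).
Proof.
move=> valid_s L_ok /forallP all_L v; have := L_ok v; have := all_L v.
case: (L v) => [e|] /=; first by move=> _ [].
rewrite implybF => /(partitionP _ _ valid_s) no_walk _ d' /walk_sym walk_d'.
by case: no_walk; exists d'.
Qed.

Lemma rejected r m d L zs :
  exists d' L', foldl (read_level r m) (false, d, L) zs = (false, d', L').
Proof. by elim: zs d L => [|z zs IHzs] d L /=; [exists d, L | apply: IHzs]. Qed.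

(* Only the first dishonest level matters: once it is caught the verifier has
   rejected, and the levels before it do not depend on the seed. *)
Lemma soundness s zs d L : valid_stream n W s -> exact_up_to s d L ->
  exists B : {set seed}, 3 * #|B| <= 3 ^ n /\
    forall r, r \notin B -> forall ok (dd : dist), d = dd ->
      let: (ok', d', L') := foldl (read_level r (memory_of r s)) (ok, dd, L) zs in
      ok' -> exact_up_to s d' L'.
Proof.
move=> valid_s; elim: zs d L => [|z zs IHzs] d L L_ok.
  exists set0; rewrite cards0; split=> // r _ ok dd def_d /= _; by rewrite -def_d.
have [le_nW|lt_d] := leqP (n * W) d.
  exists set0; rewrite cards0; split=> // r _ ok dd def_d /=.
  rewrite -def_d [d < _]ltnNge le_nW andbF.
  by have [d' [L' ->]] := rejected r (memory_of r s) (inord d.+1) (add_level L d.+1 z) zs.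
have [/forallP zE|/forallPn[v neq_v]] := boolP [forall v, z v == tight s L d.+1 v :> nat].
  have [|B [card_B B_ok]] := IHzs d.+1 (add_level L d.+1 z).
    by apply: exact_add_level => // v; apply/eqP.
  exists B; split=> // r r_B ok dd def_d /=; rewrite -def_d.
  by apply: B_ok => //; rewrite inordK.
exists [set r : seed | \sum_u z u * r u == \sum_u tight s L d.+1 u * r u].
split=> [|r].
  by have := @card_dot_collision _ (fun u => z u : nat) _ v neq_v; rewrite card_ord.
rewrite inE => /negPf neq_r ok dd def_d /=.
rewrite -def_d memory_ofE /= sketched_tightE // neq_r !andbF.
set m := (_, _).
by have [d' [L' ->]] := rejected r m (inord d.+1) (add_level L d.+1 z) zs.
Qed.

(** The levels and the labels are fixed before the seed: honest help passes for every [r]. *)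
Lemma completeness s m : valid_stream n W s -> m <= n * W ->
  exists zs (L : labelling), [/\ size zs = m, exact_up_to s m L &
    forall r, foldl (read_level r (memory_of r s)) progress0 zs = (true, inord m, L)].
Proof.
move=> valid_s; elim: m => [|m IHm] lt_m.
  exists [::], labels0; split=> //; first exact: exact_labels0.
  by move=> r; congr (_, _, _); apply/val_inj; rewrite /= inordK.
have [zs [L [sz_zs L_ok run_zs]]] := IHm (ltnW lt_m).
pose z : level := [ffun v => inord (tight s L m.+1 v)].
have zE v : z v = tight s L m.+1 v :> nat by rewrite ffunE inordK // ltnS tight_le.
exists (rcons zs z), (add_level L m.+1 z); split; first by rewrite size_rcons sz_zs.
  exact: exact_add_level.
move=> r; rewrite foldl_rcons run_zs /= inordK 1?leqW // lt_m /=.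
rewrite memory_ofE sketched_tightE //; congr (_, _, _).
by apply/eqP/eq_bigr => v _; rewrite zE.
Qed.

End Graph.

(** * Counting the bits of memory *)

Lemma card_ffun_le (I T : finType) k m :
  #|T| <= 2 ^ k -> k * #|I| <= m -> #|{ffun I -> T}| <= 2 ^ m.
Proof.
move=> leT le_m; apply: leq_trans (leq_pexp2l _ le_m) => //; rewrite card_ffun expnM.
by case: #|I| => [|i] //; rewrite leq_exp2r.
Qed.

Lemma card_prod_le (S T : finType) j k :
  #|S| <= 2 ^ j -> #|T| <= 2 ^ k -> #|{: S * T}| <= 2 ^ (j + k).
Proof. by move=> leS leT; rewrite card_prod expnD leq_mul. Qed.

Section Size.

Variables (n W : nat).
Hypotheses (n_gt0 : 0 < n) (W_gt0 : 0 < W).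
Let p := polylog n 1.

Lemma leq_polylog : n * 2 <= 2 ^ p.
Proof. by rewrite /p /polylog expn1 expnS mulnC leq_mul // up_logP. Qed.

Let p_gt0 : 0 < p. Proof. by rewrite /p /polylog expn1. Qed.

(** One more than the size of [dist], to make room for [None] in a label. *)
Lemma size_dist : (n * W).+2 <= 2 ^ (2 * (W * p)).
Proof.
have le1 : (n * W).+2 <= 2 ^ (p + W).
  have := leq_polylog; have := ltn_expl W (ltnSn 1); rewrite expnD.
  move: (2 ^ p) (2 ^ W) => x y; nia.
by apply: leq_trans le1 _; rewrite leq_exp2l //; nia.
Qed.

Lemma size_state : #|{: ({ffun 'I_W.+1 * 'I_n -> 'I_(2 * n).+1} * {ffun 'I_n -> 'I_n}) *
    ((bool * 'I_(n * W).+1 * {ffun 'I_n -> option 'I_(n * W).+1}) * 'I_(2 ^ (n * p))) }|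
  <= 2 ^ (11 * (W * n) * p).
Proof.
have -> : 11 * (W * n) * p =
    4 * (W * n) * p + W * n * p +
    (W * n * p + 2 * (W * n) * p + 2 * (W * n) * p + W * n * p).
  by lia.
have lep := leq_polylog; have led := size_dist.
apply: card_prod_le; [apply: card_prod_le|apply: card_prod_le;
  [apply: card_prod_le; [apply: card_prod_le|]|]].
- apply: (@card_ffun_le _ _ (2 * p)); rewrite ?card_prod !card_ord; last nia.
  by rewrite [2 * p]mul2n -addnn expnD; move: (2 ^ p) lep => x; nia.
- by apply: (@card_ffun_le _ _ p); rewrite !card_ord; nia.
- by rewrite card_bool (@leq_exp2l 2 1) // !muln_gt0 W_gt0 n_gt0.
- rewrite card_ord; apply: leq_trans (leq_trans led _); first exact: leqW.
  by rewrite leq_exp2l //; nia.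
- apply: (@card_ffun_le _ _ (2 * (W * p))); rewrite ?card_option card_ord //; nia.
- by rewrite card_ord leq_exp2l //; nia.
Qed.

End Size.

Theorem theorem5p5 :
  exists c k : nat,
  forall (n W : nat) (vs : 'I_n), 1 <= W ->
  exists V : verifier token ('I_n -> option nat) (c * (W * n) * polylog n k),
    (* perfect completeness, with help of length O~(D n) *)
    (forall s : seq token, valid_stream n W s ->
     forall a, sssp_correct s vs a ->
     exists help : seq bool,
       size help <= c * ((max_dist a).+1 * n) * polylog n k /\
       forall r : 'I_(nseeds V),
         match run V r s help with
         | Some a' => sssp_correct s vs a'
         | None => False
         end)
    /\
    (* soundness error at most 1/3 against every help message *)
    (forall s : seq token, valid_stream n W s ->
     forall help : seq bool,
     exists B : {set 'I_(nseeds V)},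
       3 * #|B| <= nseeds V /\
       forall r : 'I_(nseeds V), r \notin B ->
         match run V r s help with
         | Some a' => sssp_correct s vs a'
         | None => True
         end).
Proof.
exists 11, 1 => n W vs W_gt0; have n_gt0 : 0 < n by apply: leq_ltn_trans (ltn_ord vs).
have seedE : #|{ffun 'I_n -> 'I_3}| = 3 ^ n by rewrite card_ffun !card_ord.
(* A block is one level: [n] counts of [polylog n 1] bits each. *)
have := @block_verifier token ('I_n -> option nat) {ffun 'I_n -> 'I_3}
  _ _ {ffun 'I_n -> 'I_n.+1}
  (n * polylog n 1) (11 * (W * n) * polylog n 1) [ffun=> ord0]
  (sketch0 n W, partition0 n) (@read_token n W vs)
  (progress0 W vs) (@read_level n W) (@answer n W vs).
case.
- by rewrite muln_gt0 n_gt0.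
- apply: (@card_ffun_le _ _ (polylog n 1)); rewrite !card_ord; last by rewrite mulnC.
  by apply: leq_trans (leq_polylog n); lia.
- by rewrite seedE expn_gt0.
(* Two bits suffice for each coordinate of the seed. *)
- apply: (@card_ffun_le _ _ 2); rewrite !card_ord //.
  have -> : 11 * (W * n) * polylog n 1 = 11 * (W * polylog n 1) * n by lia.
  by rewrite leq_mul // (@leq_trans 11) // leq_pmulr // muln_gt0 W_gt0.
- exact: size_state.
move=> V [e [blocks [nseedsE e_inj blocks_surj runE]]]; exists V; split=> s valid_s.
  move=> a a_ok; have le_D := sssp_correct_le valid_s a_ok.
  have [zs [L [sz_zs L_ok run_zs]]] := completeness vs valid_s le_D.
  have [help sz_help blocks_help] := blocks_surj zs.
  exists help; split=> [|r]; first by rewrite sz_help sz_zs; nia.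
  rewrite runE blocks_help /= run_zs memory_ofE /=.
  case: ifP => [|/negP[]]; first exact: exact_correct L_ok.
  (* An unlabelled vertex of the source's component would be farther than [max_dist a]. *)
  apply/forallP=> v; apply/implyP=> /(partitionP vs _ _ valid_s)[d /walk_sym walk_d].
  have := L_ok v; case: (L v) => // gt_D.
  have := a_ok v; case av: (a v) => [d'|]; last by move/(_ d).
  case=> /gt_D; rewrite ltnNge => /negP[].
  by have := @leq_bigmax _ (fun u => odflt 0 (a u)) v; rewrite av.
move=> help; have [B [card_B B_ok]] :=
  soundness (blocks help) valid_s (exact_labels0 vs valid_s).
(* Injectivity of [e] keeps the preimage no larger than [B]. *)
exists (e @^-1: B); split=> [|r].
  apply: (@leq_trans (3 ^ n)); last by rewrite -seedE nseedsE.
  apply: leq_trans card_B; rewrite leq_mul2l /=.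
  rewrite -(card_imset _ e_inj); apply/subset_leq_card/subsetP=> _ /imsetP[r r_B ->].
  by rewrite inE in r_B.
rewrite inE => r_B; rewrite runE /=; have := B_ok _ r_B true ord0 erefl.
rewrite -/(progress0 W vs); case: foldl => [[ok d] L] /=.
case: ifP => // /andP[-> all_L] /(_ isT).
by move=> L_ok; apply: exact_correct L_ok _ => //; rewrite memory_ofE in all_L.
Qed.
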